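(* Let $p\le n$ be positive integers, $X\in\mathrm{Sp}(2p,2n)$ and $t\in\mathbb{R}$. Let $S=LR^\top+RL^\top=UV^\top$, where $L,R\in\mathbb{R}^{2n\times 2p}$, $U=[L\;\;R]\in\mathbb{R}^{2n\times 4p}$ and $V=[R\;\;L]\in\mathbb{R}^{2n\times 4p}$. If $I_{4p}+\frac t2V^\top J_{2n}^\top U$ is invertible, then $$Y_X^{\mathrm{cay}}(t;S):=\left(I_{2n}-\tfrac t2SJ_{2n}\right)^{-1}\left(I_{2n}+\tfrac t2SJ_{2n}\right)X$$ admits the expression $$Y_X^{\mathrm{cay}}(t;S)=X+tU\left(I_{4p}+\tfrac t2V^\top J_{2n}^\top U\right)^{-1}V^\top J_{2n}X.$$ In particular, let $\rho>0$, let $f:\mathrm{Sp}(2p,2n)\to\mathbb{R}$ have a smooth extension $\bar f$ around $X$ in $\mathbb{R}^{2n\times 2p}$ with Euclidean gradient $\nabla\bar f(X)$ at $X$, and put $H_X=\frac\rho2XX^\top+J_{2n}X_\perp X_\perp^\top J_{2n}^\top$, $P_f=H_X\nabla\bar f(X)$, $E_\rho=\frac\rho2X^\top\nabla\bar f(X)$. If $L=-P_f$ and $R=XJ_{2p}$ (and $I_{4p}+\frac t2V^\top J_{2n}^\top U$ is invertible for this choice, i.e., with $U=[-P_f\;\;XJ_{2p}]$ and $V=[XJ_{2p}\;\;-P_f]$), then $S=-S_X$ with $S_X=P_f(XJ_{2p})^\top+XJ_{2p}P_f^\top$, and $\mathcal{R}_X^{\mathrm{cay}}(-t\,\mathrm{grad}_\rho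 f(X))$ is given by $$Y_X^{\mathrm{cay}}(t;-S_X)=X+t\,[-P_f\;\;XJ_{2p}]\left(I_{4p}+\frac t2\begin{bmatrix} E_\rho & J_{2p}^\top \\ P_f^\top J_{2n}^\top P_f & -E_\rho^\top \end{bmatrix}\right)^{-1}\begin{bmatrix} I_{2p} \\ -E_\rho^\top J_{2p} \end{bmatrix}.$$
   Context: For a positive integer $m$, $J_{2m}=\begin{bmatrix} 0 & I_m \\ -I_m & 0 \end{bmatrix}$. The symplectic Stiefel manifold is $\mathrm{Sp}(2p,2n)=\{X\in\mathbb{R}^{2n\times 2p}: X^\top J_{2n}X=J_{2p}\}$, an embedded submanifold of $\mathbb{R}^{2n\times 2p}$, with tangent space $\mathrm{T}_X\mathrm{Sp}(2p,2n)$ at $X$. $X_\perp\in\mathbb{R}^{2n\times(2n-2p)}$ denotes a full rank matrix whose columns span the orthogonal complement of the column span of $X$ (the empty matrix when $p=n$, in which case terms involving it vanish); then $E=[XJ_{2p}\;\;J_{2n}X_\perp]$ is invertible. The metric $g_\rho$ is given at $X$ by $g_\rho(Z_1,Z_2)=\frac1\rho\mathrm{tr}(W_1^\top W_2)+\mathrm{tr}(K_1^\top K_2)$ where $\begin{bmatrix} W_i \\ K_i \end{bmatrix}=E^{-1}Z_i$. The Riemannian gradient $\mathrm{grad}_\rho f(X)$ is the unique element of $\mathrm{T}_X\mathrm{Sp}(2p,2n)$ with $g_\rho(\mathrm{grad}_\rho f(X),Z)=\mathrm{tr}(\nabla\bar f(X)^\top Z)$ for all $Z\in\mathrm{T}_X\mathrm{Sp}(2p,2n)$;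 it equals $S_XJ_{2n}X$ with $S_X$ as in the claim. The Cayley retraction is, for $Z\in\mathrm{T}_X\mathrm{Sp}(2p,2n)$, $\mathcal{R}^{\mathrm{cay}}_X(Z)=(I_{2n}-\frac12S_{X,Z}J_{2n})^{-1}(I_{2n}+\frac12S_{X,Z}J_{2n})X$, where $S_{X,Z}=G_XZ(XJ_{2p})^\top+XJ_{2p}(G_XZ)^\top$ and $G_X=I_{2n}-\frac12XJ_{2p}X^\top J_{2n}^\top$, defined whenever $I_{2n}-\frac12S_{X,Z}J_{2n}$ is invertible. *)

(* Defs.v *)
From HB Require Import structures.
From mathcomp Require Import all_boot all_order all_algebra.
From mathcomp Require Import all_classical all_reals all_analysis.
Set Implicit Arguments.
Unset Strict Implicit.
Unset Printing Implicit Defensive.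
Import Order.TTheory GRing.Theory Num.Theory.
Import numFieldNormedType.Exports.
Local Open Scope classical_set_scope.
Local Open Scope ring_scope.

(* A map is of class C^(k+1) on an open set A when it is differentiable on A
   and all its directional derivatives are of class C^k on A; in finite
   dimension this is the usual notion. *)
Fixpoint Ck_on (R : realType) (V W : normedModType R) (k : nat)
    (A : set V) (f : V -> W) : Prop :=
  match k with
  | 0 => forall x, A x -> {for x, continuous f}
  | k'.+1 => (forall x, A x -> differentiable f x) /\
             forall v : V, Ck_on k' A (fun x => derive f x v)
  end.

Definition smooth_on (R : realType) (V W : normedModType R)
    (A : set V) (f : V -> W) : Prop :=
  open A /\ forall k, Ck_on k A f.

(* J_{2m}; indices in R^{2m} are typed as m + m. *)
Definition Jmx (R : realType) (m : nat) : 'M[R]_(m + m) :=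
  block_mx 0 1%:M (- 1%:M) 0.
Notation "''J_' m" := (Jmx _ m) (at level 8, m at level 2, format "''J_' m").

Section SymplecticStiefel.
Variables (R : realType) (p n : nat).
Implicit Types (X Z : 'M[R]_(n + n, p + p)) (S : 'M[R]_(n + n)).

Definition SpStiefel : set 'M[R]_(n + n, p + p) :=
  [set X | X^T *m 'J_n *m X = 'J_p].

(* Tangent vectors are the velocities at 0 of smooth curves on the manifold. *)
Definition tangent_space X : set 'M[R]_(n + n, p + p) :=
  [set Z | exists (A : set R) (c : R -> 'M[R]_(n + n, p + p)),
     [/\ A 0, smooth_on A c, forall s, A s -> SpStiefel (c s),
         c 0 = X & derive1 c 0 = Z]].

Definition orth_complement_mx X (Xp : 'M[R]_(n + n, n + n - (p + p))) : Prop :=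
  \rank Xp = (n + n - (p + p))%N /\
  forall v : 'cV[R]_(n + n),
    (exists w, v = Xp *m w) <-> (forall u : 'cV[R]_(p + p), (X *m u)^T *m v = 0).

Lemma frame_dim (hpn : (p <= n)%N) : (p + p + (n + n - (p + p)) = n + n)%N.
Proof. by rewrite subnKC // leq_add. Qed.

(* E = [X J_{2p}  J_{2n} X_perp], made square by a cast. *)
Definition frame_mx (hpn : (p <= n)%N) X (Xp : 'M[R]_(n + n, n + n - (p + p))) :
    'M[R]_(n + n) :=
  castmx (erefl, frame_dim hpn) (row_mx (X *m 'J_p) ('J_n *m Xp)).

(* The stacked blocks [W; K] = E^-1 Z. *)
Definition frame_coord (hpn : (p <= n)%N) X
    (Xp : 'M[R]_(n + n, n + n - (p + p))) Z :
    'M[R]_(p + p + (n + n - (p + p)), p + p) :=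
  castmx (esym (frame_dim hpn), erefl) (invmx (frame_mx hpn X Xp) *m Z).

Definition metric (hpn : (p <= n)%N) (rho : R) X
    (Xp : 'M[R]_(n + n, n + n - (p + p))) Z1 Z2 : R :=
  let C1 := frame_coord hpn X Xp Z1 in
  let C2 := frame_coord hpn X Xp Z2 in
  rho^-1 * \tr ((usubmx C1)^T *m usubmx C2) + \tr ((dsubmx C1)^T *m dsubmx C2).

Definition euclid_grad (fbar : 'M[R]_(n + n, p + p) -> R) X :
    'M[R]_(n + n, p + p) :=
  \matrix_(i, j) derive fbar X (delta_mx i j).

Definition smooth_extension (f : SpStiefel -> R)
    (fbar : 'M[R]_(n + n, p + p) -> R) X : Prop :=
  exists N : set 'M[R]_(n + n, p + p),
    [/\ N X, smooth_on N fbar &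
        forall Y : SpStiefel, N (val Y) -> fbar (val Y) = f Y].

Definition is_riemannian_grad (hpn : (p <= n)%N) (rho : R)
    (Xp : 'M[R]_(n + n, n + n - (p + p)))
    (fbar : 'M[R]_(n + n, p + p) -> R) X (G : 'M[R]_(n + n, p + p)) : Prop :=
  tangent_space X G /\
  forall Z, tangent_space X Z ->
    metric hpn rho X Xp G Z = \tr ((euclid_grad fbar X)^T *m Z).

(* "The" matrix satisfying is_riemannian_grad (0 if there were none). *)
Definition riemannian_grad (hpn : (p <= n)%N) (rho : R)
    (Xp : 'M[R]_(n + n, n + n - (p + p)))
    (fbar : 'M[R]_(n + n, p + p) -> R) X : 'M[R]_(n + n, p + p) :=
  xget 0 [set G | is_riemannian_grad hpn rho Xp fbar X G].

(* Since invmx is total, the value is meaningful only when cayley_defined. *)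
Definition cayley_defined (t : R) S : Prop :=
  1%:M - (t / 2) *: (S *m 'J_n) \in unitmx.

Definition cayley_curve X (t : R) S : 'M[R]_(n + n, p + p) :=
  invmx (1%:M - (t / 2) *: (S *m 'J_n)) *m (1%:M + (t / 2) *: (S *m 'J_n)) *m X.

Definition cayley_G X : 'M[R]_(n + n) :=
  1%:M - 2^-1 *: (X *m 'J_p *m X^T *m ('J_n)^T).

Definition cayley_S X Z : 'M[R]_(n + n) :=
  cayley_G X *m Z *m (X *m 'J_p)^T + X *m 'J_p *m (cayley_G X *m Z)^T.

(* Domain of the Cayley retraction at X. *)
Definition cayley_dom X : set 'M[R]_(n + n, p + p) :=
  [set Z | tangent_space X Z /\
           1%:M - 2^-1 *: (cayley_S X Z *m 'J_n) \in unitmx].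

(* Meaningful only for Z in cayley_dom X. *)
Definition cayley_retraction X Z : 'M[R]_(n + n, p + p) :=
  invmx (1%:M - 2^-1 *: (cayley_S X Z *m 'J_n))
    *m (1%:M + 2^-1 *: (cayley_S X Z *m 'J_n)) *m X.

End SymplecticStiefel.

Arguments SpStiefel : clear implicits.

(* Main.v *)
Require Import Defs.
From mathcomp Require Import all_boot all_order all_algebra.
From mathcomp Require Import all_classical all_reals all_analysis.
From mathcomp Require Import ring.
Import Order.TTheory GRing.Theory Num.Theory.
Import numFieldNormedType.Exports.
Local Open Scope ring_scope.

Set Implicit Arguments.
Unset Strict Implicit.
Unset Printing Implicit Defensive.

(** Both formulas are instances of the push-through identity
    (I - AB)^-1 A = A (I - BA)^-1: since I + AB = (I - AB) + 2AB, the Cayley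
    transform (I - AB)^-1 (I + AB) equals I + 2 A (I - BA)^-1 B.  With
    A = (t/2) U and B = V^T J this trades the inverse of a 2n x 2n matrix for
    that of a 4p x 4p one ([cayley_factoredE]).

    The formula for the gradient needs two further facts.  The first is that
    the Riemannian gradient is S_X J X.  A curve on the manifold satisfies
    c^T J c = J, so its velocity Z satisfies X^T J Z + Z^T J X = 0;
    conversely such a Z equals S_{X,Z} J X with S_{X,Z} symmetric, and is the
    velocity of the Cayley curve of S_{X,Z}, which stays on the manifold and
    is smooth because its entries are rational functions of the parameter
    ([tangent_spaceP]).  In the frame E = [X J, J X_perp] the coordinate W of
    Z is X^T J^T Z, which is a symmetric matrix exactly when Z is tangent.
    The vector S_X J X has coordinates W_0 = rho sym(D^T X J) and
    K_0 = X_perp^T J^T D, where D is the Euclidean gradient, and tr(D^T X J W)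
    depends only on the symmetric part of D^T X J when W is symmetric; hence
    g_rho(S_X J X, Z) = tr(D^T Z) ([metric_gradient]).  The metric is
    positive definite because E is invertible, so the gradient is unique
    ([riemannian_gradE]).

    The second is that S_{X, S J X} = S for every S of the form
    L (X J)^T + X J L^T ([cayley_S_sym_pair]).  By linearity the retraction at
    - t grad is then the Cayley curve of - S_X at time t, and it remains to
    evaluate the blocks of V^T J^T U and V^T J X ([gradient_kernelE]). *)

(** * The symplectic form and the Cayley transform *)

Section Cayley.
Variable R : realType.

Lemma trmx_J m : ('J_m)^T = - 'J_m :> 'M[R]_(m + m).
Proof.
rewrite /Jmx tr_block_mx opp_block_mx !trmx0 linearN /= trmx1 opprK.
by rewrite !raddf0.
Qed.

Lemma mulmx_JJ m : 'J_m *m 'J_m = - 1%:M :> 'M[R]_(m + m).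
Proof.
rewrite /Jmx mulmx_block !mul0mx !mulmx0 !mulmxN !mulNmx !mulmx1 !add0r !addr0.
by rewrite [in RHS]scalar_mx_block opp_block_mx !oppr0.
Qed.

Lemma trJ_mulJ m : ('J_m)^T *m 'J_m = 1%:M :> 'M[R]_(m + m).
Proof. by rewrite trmx_J mulNmx mulmx_JJ opprK. Qed.

Lemma J_mul_trJ m : 'J_m *m ('J_m)^T = 1%:M :> 'M[R]_(m + m).
Proof. by rewrite trmx_J mulmxN mulmx_JJ opprK. Qed.

(** The inverse of I - AB is I + A (I - BA)^-1 B, which is how invertibility
    passes from the small matrix to the large one. *)
Lemma unitmx_push_through m k (A : 'M[R]_(m, k)) (B : 'M[R]_(k, m)) :
  1%:M - B *m A \in unitmx ->
  1%:M - A *m B \in unitmx /\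
  invmx (1%:M - A *m B) *m A = A *m invmx (1%:M - B *m A).
Proof.
move=> uBA.
have push : (1%:M - A *m B) *m A = A *m (1%:M - B *m A).
  by rewrite mulmxBl mulmxBr mul1mx mulmx1 mulmxA.
have uAB : 1%:M - A *m B \in unitmx.
  have inv_r : (1%:M - A *m B) *m
      (1%:M + A *m invmx (1%:M - B *m A) *m B) = 1%:M.
    by rewrite mulmxDr mulmx1 !mulmxA push mulmxK// subrK.
  by have [] := mulmx1_unit inv_r.
split=> //.
by rewrite -[LHS](mulmxK uBA) -(mulmxA _ A) -push mulmxA mulVmx// mul1mx.
Qed.

Lemma cayley_woodbury m k q (A : 'M[R]_(m, k)) (B : 'M[R]_(k, m))
    (Y : 'M[R]_(m, q)) :
  1%:M - B *m A \in unitmx ->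
  invmx (1%:M - A *m B) *m (1%:M + A *m B) *m Y =
  Y + 2 *: (A *m invmx (1%:M - B *m A) *m B *m Y).
Proof.
move=> /unitmx_push_through[uAB push].
have -> : 1%:M + A *m B = (1%:M - A *m B) + 2 *: (A *m B).
  by rewrite scaler_nat mulr2n addrACA addNr addr0.
rewrite mulmxDr mulVmx// -scalemxAr mulmxA push mulmxDl mul1mx.
by rewrite -scalemxAl.
Qed.

Lemma addr_halves m k (A : 'M[R]_(m, k)) : 2^-1 *: A + 2^-1 *: A = A.
Proof. by rewrite -mulr2n -scaler_nat scalerA divff ?scale1r ?pnatr_eq0. Qed.

Section Curve.
Variables (p n : nat).
Implicit Types (X Z L : 'M[R]_(n + n, p + p)) (S : 'M[R]_(n + n)).

(** This brings the small matrix into the shape I - BA. *)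
Lemma woodbury_kernelE (t : R) k (U V : 'M[R]_(n + n, k)) :
  1%:M + (t / 2) *: (V^T *m ('J_n)^T *m U) =
  1%:M - (V^T *m 'J_n) *m ((t / 2) *: U).
Proof. by rewrite trmx_J mulmxN mulNmx scalerN -scalemxAr. Qed.

Lemma cayley_factoredE X (t : R) k (U V : 'M[R]_(n + n, k)) :
  1%:M + (t / 2) *: (V^T *m ('J_n)^T *m U) \in unitmx ->
  cayley_defined t (U *m V^T) /\
  cayley_curve X t (U *m V^T) =
    X + t *: (U *m invmx (1%:M + (t / 2) *: (V^T *m ('J_n)^T *m U))
                *m V^T *m 'J_n *m X).
Proof.
rewrite woodbury_kernelE => uK.
have AB : (t / 2) *: (U *m V^T *m 'J_n) = ((t / 2) *: U) *m (V^T *m 'J_n).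
  by rewrite -scalemxAl mulmxA.
rewrite /cayley_defined /cayley_curve AB; split.
  by have [] := unitmx_push_through uK.
rewrite cayley_woodbury// -!scalemxAl scalerA mulrCA divff ?mulr1 ?pnatr_eq0//.
by rewrite !mulmxA.
Qed.

(** B = (s/2) S J is Hamiltonian (B^T J = - J B) when S is symmetric, so both
    (I + B)^T J (I + B) and (I - B)^T J (I - B) equal J - J B B; as I + B and
    I - B commute, their quotient is a symplectic matrix. *)
Lemma cayley_preserves_form X (s : R) S : S^T = S -> cayley_defined s S ->
  SpStiefel R p n X -> SpStiefel R p n (cayley_curve X s S).
Proof.
rewrite /cayley_defined /cayley_curve /SpStiefel/=.
set B := (s / 2) *: _ => symS uN hX.
have BJ : B^T *m 'J_n = - ('J_n *m B).
  rewrite /B linearZ /= trmx_mul symS trmx_J -scalemxAl -scalemxAr -scalerN.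
  by congr (_ *: _); rewrite !mulNmx mulmxA.
set N := _ - B in uN *; set P := _ + B.
have PN : P *m N = N *m P.
  rewrite /N mulmxBr mulmxBl mulmx1 mul1mx; congr (_ - _).
  by rewrite /P mulmxDl mulmxDr mulmx1 mul1mx.
have : invmx N *m P *m N = P by rewrite -mulmxA PN mulmxA mulVmx// mul1mx.
(* Abstracting the quotient Q keeps only the equation Q (I - B) = I + B. *)
set Q := invmx N *m P; clearbody Q => QN.
have formPN : P^T *m 'J_n *m P = N^T *m 'J_n *m N.
  rewrite /P /N [(_ + _)^T]linearD [(_ - _)^T]linearB /= trmx1.
  rewrite !mulmxDr !mulmxN !mulmxDl !mulNmx !mulmx1 !mul1mx BJ.
  by rewrite !mulNmx !opprK addrA addrNK opprD addrA addrK.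
have formQ : Q^T *m 'J_n *m Q = 'J_n.
  have uNt : N^T \in unitmx by rewrite unitmx_tr.
  apply: (can_inj (mulKmx uNt)); apply: (can_inj (mulmxK uN)).
  by rewrite -formPN -QN trmx_mul !mulmxA.
by rewrite trmx_mul mulmxA -2!(mulmxA X^T) formQ.
Qed.

(** * Symmetric generators and the linearized constraint *)

(** The rows of (X J)^T J are the functionals dual to the columns of X. *)
Lemma SpStiefel_dual X : SpStiefel R p n X -> (X *m 'J_p)^T *m 'J_n *m X = 1%:M.
Proof.
rewrite /SpStiefel/= => hX.
by rewrite trmx_mul -mulmxA -mulmxA [X^T *m _]mulmxA hX trJ_mulJ.
Qed.

Lemma SpStiefel_frame_form X : SpStiefel R p n X ->
  (X *m 'J_p)^T *m ('J_n)^T *m (X *m 'J_p) = ('J_p)^T.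
Proof.
move=> hX.
by rewrite trmx_J mulmxN mulNmx mulmxA SpStiefel_dual// mul1mx trmx_J.
Qed.

(** The constraint X^T J X = J linearized at X. *)
Definition tangent_eq X Z : Prop := X^T *m 'J_n *m Z + Z^T *m 'J_n *m X = 0.

Lemma tangent_eqP X Z : tangent_eq X Z <->
  (X^T *m 'J_n *m Z)^T = X^T *m 'J_n *m Z.
Proof.
rewrite !trmx_mul trmxK trmx_J mulNmx mulmxN mulmxA /tangent_eq.
split=> [/eqP|<-]; last by rewrite addNr.
by rewrite addr_eq0 => /eqP ->.
Qed.

Lemma sym_J_tangent X S : S^T = S -> tangent_eq X (S *m 'J_n *m X).
Proof.
move=> symS; apply/tangent_eqP.
by rewrite !trmx_mul trmxK symS trmx_J !(mulmxN, mulNmx) opprK !mulmxA.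
Qed.

(** The generators of the Cayley curves: S_X is [sym_pair X P_f], and S_{X,Z}
    is [sym_pair X (G_X Z)]. *)
Definition sym_pair X L : 'M[R]_(n + n) :=
  L *m (X *m 'J_p)^T + X *m 'J_p *m L^T.

Lemma sym_pair_sym X L : (sym_pair X L)^T = sym_pair X L.
Proof. by rewrite /sym_pair linearD /= !trmx_mul !trmxK addrC. Qed.

Lemma sym_pair_JX X L : SpStiefel R p n X ->
  sym_pair X L *m 'J_n *m X = L + X *m 'J_p *m (L^T *m 'J_n *m X).
Proof.
move=> hX; rewrite /sym_pair !mulmxDl; congr (_ + _); last by rewrite !mulmxA.
by rewrite -!mulmxA (mulmxA _ 'J_n) SpStiefel_dual// mulmx1.
Qed.

(** The kernel of L |-> [sym_pair X L] contains X J C for C skew; this is what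
    makes S_{X, S J X} = S possible although S J X involves L twice. *)
Lemma sym_pair_shift X L C : C^T = - C ->
  sym_pair X (L + X *m 'J_p *m C) = sym_pair X L.
Proof.
move=> skewC; rewrite /sym_pair mulmxDl linearD /= mulmxDr addrACA.
by rewrite [(_ *m C)^T]trmx_mul skewC mulNmx mulmxN mulmxA subrr addr0.
Qed.

Lemma cayley_GE X Z :
  cayley_G X *m Z = Z + 2^-1 *: (X *m 'J_p *m (X^T *m 'J_n *m Z)).
Proof.
rewrite /cayley_G mulmxBl mul1mx trmx_J mulmxN scalerN mulNmx opprK.
by rewrite -scalemxAl !mulmxA.
Qed.

Lemma cayley_SE X Z : cayley_S X Z = sym_pair X (cayley_G X *m Z).
Proof. by []. Qed.

(** With A = X^T J Z symmetric, G_X Z = Z + (1/2) X J A and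
    (G_X Z)^T J X = - (1/2) A, so the two corrections to Z cancel. *)
Lemma cayley_S_recovers X Z : SpStiefel R p n X -> tangent_eq X Z ->
  cayley_S X Z *m 'J_n *m X = Z.
Proof.
move=> hX tZ; rewrite cayley_SE sym_pair_JX// cayley_GE.
set A := X^T *m 'J_n *m Z.
have hA : A^T = A by apply/tangent_eqP.
have -> : (Z + 2^-1 *: (X *m 'J_p *m A))^T *m 'J_n *m X = - (2^-1 *: A).
  rewrite linearD /= linearZ /= [(_ *m A)^T]trmx_mul hA !mulmxDl -!scalemxAl.
  rewrite -2!(mulmxA A) SpStiefel_dual// mulmx1.
  have -> : Z^T *m 'J_n *m X = - A.
    by apply/eqP; rewrite -addr_eq0 addrC; apply/eqP.
  by rewrite -{1}[A]addr_halves opprD addrNK.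
by rewrite mulmxN -scalemxAr addrK.
Qed.

(** With B = L^T J X one finds G_X (S J X) = L + (1/2) X J (B - B^T), which
    differs from L by a shift that [sym_pair] does not see. *)
Lemma cayley_S_sym_pair X L : SpStiefel R p n X ->
  cayley_S X (sym_pair X L *m 'J_n *m X) = sym_pair X L.
Proof.
move=> hX; rewrite cayley_SE cayley_GE sym_pair_JX//.
set B := L^T *m 'J_n *m X.
have -> : X^T *m 'J_n *m (L + X *m 'J_p *m B) = - B^T - B.
  rewrite mulmxDr /B !trmx_mul trmxK trmx_J mulNmx mulmxN opprK !mulmxA.
  by rewrite [X^T *m _ *m X]hX mulmx_JJ !mulNmx mul1mx.
rewrite -addrA scalemxAr -mulmxDr sym_pair_shift//.
have -> : B + 2^-1 *: (- B^T - B) = 2^-1 *: (B - B^T).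
  apply: (scalerI (a := 2)); first by rewrite pnatr_eq0.
  rewrite scalerDr !scalerA divff ?pnatr_eq0// !scale1r scaler_nat mulr2n.
  by rewrite addrACA subrr addr0.
by rewrite linearZ /= linearB /= trmxK -scalerN opprB.
Qed.

Lemma sym_pairZ X L a : sym_pair X (a *: L) = a *: sym_pair X L.
Proof.
by rewrite /sym_pair linearZ /= scalerDr -scalemxAl -scalemxAr.
Qed.

End Curve.
End Cayley.

(** * Calculus of matrix-valued functions *)

Section MatrixCalculus.
Variable R : realType.

Lemma is_derive_mxP (V : normedModType R) m n (M : V -> 'M[R]_(m, n)) t v dM :
  is_derive t v M dM <->
  forall i j, is_derive t v (fun x => M x i j : R) (dM i j).
Proof.
split=> [[dM' <-] i j|dMij].
  apply: DeriveDef; first by move/derivable_mxP: dM'; exact.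
  by rewrite derive_mx// mxE.
have dM' : derivable M t v by apply/derivable_mxP => i j; have [] := dMij i j.
apply: DeriveDef => //; rewrite derive_mx//.
by apply/matrixP => i j; rewrite mxE; have [_ ->] := dMij i j.
Qed.

Lemma is_derive_mulmx (V : normedModType R) m n k
    (F : V -> 'M[R]_(m, n)) (G : V -> 'M[R]_(n, k)) t v dF dG :
  is_derive t v F dF -> is_derive t v G dG ->
  is_derive t v (fun x => F x *m G x) (dF *m G t + F t *m dG).
Proof.
move=> /is_derive_mxP hF /is_derive_mxP hG; apply/is_derive_mxP => i j.
have -> : (fun x => (F x *m G x) i j) =
    \sum_(l < n) ((fun x => F x i l : R) * (fun x => G x l j : R)).
  by apply/funext => x; rewrite mxE fct_sumE.
apply: is_derive_eq.
rewrite !mxE -big_split /=; apply: eq_bigr => l _.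
by rewrite addrC [_ *: dF _ _]mulrC.
Qed.

Lemma is_derive_trmx (V : normedModType R) m n (F : V -> 'M[R]_(m, n)) t v dF :
  is_derive t v F dF -> is_derive t v (fun x => (F x)^T) dF^T.
Proof.
move=> /is_derive_mxP hF; apply/is_derive_mxP => i j.
under [X in is_derive _ _ X _]funext => x do rewrite mxE.
by rewrite mxE.
Qed.

Lemma is_derive_affine m n (C D : 'M[R]_(m, n)) (t : R) :
  is_derive t (1 : R) (fun s : R => C + s *: D) D.
Proof.
apply/is_derive_mxP => i j.
have -> : (fun s => (C + s *: D) i j) =
    cst (C i j) + (id : R -> R) * cst (D i j).
  by apply/funext => s; rewrite !mxE.
apply: is_derive_eq.
by rewrite add0r scaler0 add0r [LHS]mulr1.
Qed.

(** The quotient rule keeps the shape (polynomial matrix) / (polynomial), which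
    is the induction step of smoothness. *)
Lemma is_derive_rational m n (q : {poly R}) (P : 'M[{poly R}]_(m, n)) (t : R) :
  q.[t] != 0 ->
  is_derive t (1 : R)
    (fun s => q.[s]^-1 *: map_mx (horner_eval s) P)
    ((q ^+ 2).[t]^-1 *: map_mx (horner_eval t)
        (map_mx (fun u => u^`() * q - u * q^`()) P)).
Proof.
move=> qt0; apply/is_derive_mxP => i j.
have -> : (fun s => (q.[s]^-1 *: map_mx (horner_eval s) P) i j) =
    (fun s => q.[s]^-1) * horner (P i j).
  by apply/funext => s; rewrite !mxE.
have dq : is_derive t (1 : R) (fun s => q.[s]^-1) (- q.[t] ^- 2 *: q^`().[t]).
  apply: DeriveDef; first by apply: derivableV => //; exact: derivable_horner.
  by rewrite deriveV// derive_val.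
apply: is_derive_eq.
rewrite !mxE /horner_eval !hornerE /= /GRing.scale /=.
by field.
Qed.

(** A directional derivative in dimension one is a multiple of the derivative;
    smoothness quantifies over all directions. *)
Lemma derive_dirE (W : normedModType R) (f : R -> W) (x v : R) :
  differentiable f x -> 'D_v f x = v *: 'D_1 f x.
Proof. by move=> df; rewrite deriveE// diff1E// derive1E. Qed.

(** The hypothesis on f is an equality on A only, because the induction applies
    the statement to derivatives, which are known to be rational on A alone. *)
Lemma rational_Ck m n k (A : set R) (f : R -> 'M[R]_(m, n)) (q : {poly R})
    (P : 'M[{poly R}]_(m, n)) :
  open A -> (forall s, A s -> q.[s] != 0) ->
  (forall s, A s -> f s = q.[s]^-1 *: map_mx (horner_eval s) P) ->
  Ck_on k A f.
Proof.
move=> oA; elim: k f q P => [|k IH] f q P q0 fE.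
all: have df s : A s -> is_derive s (1 : R) f ((q ^+ 2).[s]^-1 *:
    map_mx (horner_eval s) (map_mx (fun u => u^`() * q - u * q^`()) P)).
1,3: move=> As; apply: (near_eq_is_derive _ (is_derive_rational P (q0 s As))).
1,2: by near=> y; rewrite fE//; near: y; exact: open_nbhs_nbhs.
all: have diff_f s : A s -> differentiable f s.
1,3: by move=> As; apply/derivable1_diffP; have [] := df s As.
  by move=> s As; exact/differentiable_continuous/diff_f.
split=> // v.
apply: (IH _ (q ^+ 2)
    (map_mx (fun u => v%:P * u) (map_mx (fun u => u^`() * q - u * q^`()) P))).
  by move=> s As; rewrite horner_exp expf_neq0// q0.
move=> s As; rewrite derive_dirE; last exact: diff_f.
have [_ ->] := df s As.
rewrite scalerA mulrC -scalerA; congr (_ *: _).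
by apply/matrixP => i j; rewrite !mxE /horner_eval hornerM hornerC.
Unshelve. all: by end_near. Qed.

(** * The Cayley curve and the tangent space *)

Lemma horner_evalC m n (s : R) (M : 'M[R]_(m, n)) :
  map_mx (horner_eval s) (map_mx polyC M) = M.
Proof. by apply/matrixP => i j; rewrite !mxE /horner_eval hornerC. Qed.

Section CayleyCurve.
Variables p n : nat.
Implicit Types (X Z : 'M[R]_(n + n, p + p)) (S : 'M[R]_(n + n)).

(** The affine path s |-> I + s B as a matrix of polynomials in s. *)
Definition pencil (B : 'M[R]_(n + n)) : 'M[{poly R}]_(n + n) :=
  1%:M + 'X *: map_mx polyC B.

Lemma pencil_eval B s : map_mx (horner_eval s) (pencil B) = 1%:M + s *: B.
Proof.
apply/matrixP => i j; rewrite !mxE /horner_eval hornerD hornerM hornerX hornerC.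
by rewrite hornerMn hornerC.
Qed.

(** Cramer's rule: the inverse is the adjugate over the determinant, both
    polynomial in s. *)
Lemma cayley_curve_rational X S (s : R) :
  let B := 2^-1 *: (S *m 'J_n) in
  let q := \det (pencil (- B)) in
  (cayley_defined s S <-> q.[s] != 0) /\
  (q.[s] != 0 -> cayley_curve X s S = q.[s]^-1 *:
    map_mx (horner_eval s) (\adj (pencil (- B)) *m pencil B *m map_mx polyC X)).
Proof.
move=> B q.
have qE : q.[s] = \det (1%:M - s *: B).
  by rewrite -scalerN -pencil_eval det_map_mx.
have sB : (s / 2) *: (S *m 'J_n) = s *: B by rewrite scalerA.
rewrite /cayley_defined /cayley_curve sB !map_mxM /= map_mx_adj !pencil_eval.
rewrite scalerN horner_evalC qE unitmxE unitfE; split=> // det0.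
by rewrite /invmx unitmxE unitfE det0 -!scalemxAl.
Qed.

(** Rather than differentiating an inverse, differentiate the equation
    (I - s B) c(s) = (I + s B) X at 0: it gives c'(0) - B X = B X. *)
Lemma cayley_velocity X S (c : R -> 'M[R]_(n + n, p + p)) :
  c = (fun s => cayley_curve X s S) ->
  (\forall s \near (0 : R), cayley_defined s S) ->
  derivable c 0 1 -> derive1 c 0 = S *m 'J_n *m X.
Proof.
move=> cE cd dc; rewrite derive1E.
set B := 2^-1 *: (S *m 'J_n).
have c0 : c 0 = X.
  by rewrite cE /cayley_curve mul0r scale0r subr0 addr0 invmx1 !mul1mx.
have dl := is_derive_mulmx (is_derive_affine 1%:M (- B) 0) (derivableP dc).
have dr := is_derive_mulmx (is_derive_affine 1%:M B 0)
  (is_derive_cst X (0 : R) (1 : R)).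
have dl' : is_derive (0 : R) (1 : R) (fun s : R => (1%:M + s *: B) *m X)
   (- B *m c 0 + (1%:M + 0 *: - B) *m 'D_1 c 0).
  apply: near_eq_is_derive dl; near=> s.
  have : cayley_defined s S by near: s.
  rewrite /cayley_defined cE /cayley_curve -scalerA -/B scalerN => uN.
  by rewrite -mulmxA mulKVmx.
have [_ eql] := dl'; have [_] := dr; rewrite [X in X = _]eql => /eqP.
rewrite c0 mulmx0 addr0 scale0r addr0 mul1mx mulNmx addrC subr_eq => /eqP ->.
by rewrite -mulmxDl addr_halves.
Unshelve. all: by end_near. Qed.

(** Differentiating c^T J c = J gives the linear equation; conversely the
    Cayley curve generated by S_{X,Z} has velocity S_{X,Z} J X = Z. *)
Lemma tangent_spaceP X Z : SpStiefel R p n X ->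
  tangent_space X Z <-> tangent_eq X Z.
Proof.
move=> hX; split.
  case=> A [c [A0 [oA cA] cSp c0 <-]].
  have dc : derivable c 0 1.
    by have [/(_ _ A0)/derivable1_diffP] := cA 1%N.
  have dF := is_derive_mulmx (is_derive_mulmx (is_derive_trmx (derivableP dc))
    (is_derive_cst 'J_n (0 : R) (1 : R))) (derivableP dc).
  have : is_derive (0 : R) (1 : R) (cst 'J_p : R -> 'M[R]_(p + p))
    (('D_1 c 0)^T *m 'J_n *m c 0 + (c 0)^T *m 'J_n *m 'D_1 c 0).
    move: dF; rewrite mulmx0 addr0 => dF.
    apply: near_eq_is_derive dF; near=> s.
    by apply: cSp; near: s; exact: open_nbhs_nbhs.
  by rewrite /tangent_eq derive1E => -[_]; rewrite derive_cst c0 addrC => <-.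
move=> tZ.
set S := cayley_S X Z.
have symS : S^T = S by exact: sym_pair_sym.
pose B := 2^-1 *: (S *m 'J_n).
pose q := \det (pencil (- B)).
pose A : set R := (fun s => q.[s] != 0).
have q0 : q.[0] != 0.
  apply/(cayley_curve_rational X S 0).1.
  by rewrite /cayley_defined mul0r scale0r subr0 unitmx1.
have oA : open A.
  apply: (@open_comp _ _ (horner q) [set x | x != 0]%classic).
    by move=> s _; exact: continuous_horner.
  exact: open_neq.
have Ck k : Ck_on k A (fun s => cayley_curve X s S).
  apply: (@rational_Ck _ _ k A _ q
    (\adj (pencil (- B)) *m pencil B *m map_mx polyC X)) => // s As.
  exact: (cayley_curve_rational X S s).2.
exists A, (fun s => cayley_curve X s S); split=> //.
- move=> s As; apply: cayley_preserves_form => //.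
  exact/(cayley_curve_rational X S s).1.
- by rewrite /cayley_curve mul0r scale0r subr0 addr0 invmx1 !mul1mx.
rewrite (cayley_velocity (X := X) (S := S))//.
- exact: cayley_S_recovers.
- near=> s; apply/(cayley_curve_rational X S s).1.
  have : A s by near: s; exact: open_nbhs_nbhs.
  by [].
by have [/(_ _ q0)/derivable1_diffP] := Ck 1%N.
Unshelve. all: by end_near. Qed.

End CayleyCurve.

End MatrixCalculus.

(** * The metric and its gradient *)

Lemma mxtrace_trmul_ge0 (R : realDomainType) m n (A : 'M[R]_(m, n)) :
  0 <= \tr (A^T *m A).
Proof.
rewrite sumr_ge0// => i _; rewrite mxE sumr_ge0// => j _.
by rewrite mxE -expr2 sqr_ge0.
Qed.

Lemma mxtrace_trmul_eq0 (R : realDomainType) m n (A : 'M[R]_(m, n)) :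
  \tr (A^T *m A) = 0 -> A = 0.
Proof.
have colE j : (A^T *m A) j j = \sum_i A i j ^+ 2.
  by rewrite mxE; apply: eq_bigr => i _; rewrite mxE expr2.
have col_ge0 j : 0 <= (A^T *m A) j j.
  by rewrite colE sumr_ge0// => i _; rewrite sqr_ge0.
move=> /eqP; rewrite /mxtrace psumr_eq0// => /allP col0.
apply/matrixP => i j; rewrite mxE; apply/eqP.
have := col0 j (mem_index_enum j); rewrite colE psumr_eq0 => [/allP/=row0|k _].
  by have := row0 i (mem_index_enum i); rewrite sqrf_eq0.
by rewrite sqr_ge0.
Qed.

(** The frame is a rectangular block matrix cast to a square one; destructing
    the cast in this generality makes frame coordinates computable from any
    left inverse. *)
Lemma cast_left_inverse (K : fieldType) k m q (e : k = m) (F : 'M[K]_(k, m))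
    (M : 'M[K]_(m, k)) (Z : 'M[K]_(m, q)) : F *m M = 1%:M ->
  castmx (esym e, erefl) (invmx (castmx (erefl, e) M) *m Z) = F *m Z /\
  M *m (F *m Z) = Z.
Proof.
case: m / e F M Z => F M Z FM; rewrite !castmx_id.
have [uF uM] := mulmx1_unit FM.
have -> : F = invmx M by rewrite -[LHS](mulmxK uM) FM mul1mx.
by rewrite mulKVmx.
Qed.

Section Frame.
Variables (R : realType) (p n : nat) (hpn : (p <= n)%N).
Variables (X : 'M[R]_(n + n, p + p)) (Xp : 'M[R]_(n + n, n + n - (p + p))).
Hypotheses (hX : SpStiefel R p n X) (hXp : orth_complement_mx X Xp).
Implicit Types (Z D : 'M[R]_(n + n, p + p)).

Lemma orth_complement_mul0 : X^T *m Xp = 0.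
Proof.
apply/matrixP => i j; rewrite [RHS]mxE.
have [_ /(_ (Xp *m delta_mx j 0))[+ _]] := hXp.
move=> /(_ (ex_intro _ _ erefl)) /(_ (delta_mx i 0)) /matrixP /(_ 0 0).
rewrite [RHS]mxE => <-.
rewrite trmx_mul trmx_delta !mulmxA -(mulmxA (delta_mx _ _)) -rowE -colE.
by rewrite !mxE.
Qed.

(** X^T J^T is dual to the columns of X J and kills those of J X_perp, which
    gives the upper block.  For the lower one, take a left inverse of X_perp
    after J^T and the projection that kills the columns of X J. *)
Lemma frame_left_inverse : exists N : 'M[R]_(n + n - (p + p), n + n),
  col_mx (X^T *m ('J_n)^T) N *m row_mx (X *m 'J_p) ('J_n *m Xp) = 1%:M.
Proof.
have /row_fullP[N NXp] : row_full Xp by rewrite /row_full hXp.1.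
have dualX : X^T *m ('J_n)^T *m (X *m 'J_p) = 1%:M.
  by rewrite trmx_J mulmxN mulNmx mulmxA hX mulmx_JJ opprK.
have dualXp : X^T *m ('J_n)^T *m ('J_n *m Xp) = 0.
  by rewrite -mulmxA (mulmxA ('J_n)^T) trJ_mulJ mul1mx orth_complement_mul0.
exists (N *m ('J_n)^T *m (1%:M - X *m 'J_p *m (X^T *m ('J_n)^T))).
rewrite mul_col_row dualX dualXp -!(mulmxA _ (1%:M - _)) !mulmxBl !mul1mx.
rewrite -!(mulmxA (X *m 'J_p)) dualX dualXp mulmx1 mulmx0 subrr subr0 mulmx0.
by rewrite -mulmxA (mulmxA ('J_n)^T) trJ_mulJ mul1mx NXp -scalar_mx_block.
Qed.

Lemma frame_coordE W K :
  frame_coord hpn X Xp (X *m 'J_p *m W + 'J_n *m Xp *m K) = col_mx W K.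
Proof.
have [N NE] := frame_left_inverse.
rewrite /frame_coord -mul_row_col.
have [-> _] := cast_left_inverse (frame_dim hpn)
  (row_mx (X *m 'J_p) ('J_n *m Xp) *m col_mx W K) NE.
by rewrite mulmxA NE mul1mx.
Qed.

(** The W-coordinate has a closed form, unlike the K-coordinate, of which only
    the existence matters. *)
Lemma frame_decomp Z : exists K,
  Z = X *m 'J_p *m (X^T *m ('J_n)^T *m Z) + 'J_n *m Xp *m K.
Proof.
have [N NE] := frame_left_inverse.
exists (N *m Z).
have [_] := cast_left_inverse (frame_dim hpn) Z NE.
by rewrite (mul_col_mx _ N) mul_row_col => {1}<-.
Qed.

Lemma metricE (rho : R) W1 K1 W2 K2 :
  metric hpn rho X Xp (X *m 'J_p *m W1 + 'J_n *m Xp *m K1)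
    (X *m 'J_p *m W2 + 'J_n *m Xp *m K2) =
  rho^-1 * \tr (W1^T *m W2) + \tr (K1^T *m K2).
Proof. by rewrite /metric !frame_coordE !col_mxKu !col_mxKd. Qed.

Lemma metricBl (rho : R) Z1 Z2 Z :
  metric hpn rho X Xp (Z1 - Z2) Z =
  metric hpn rho X Xp Z1 Z - metric hpn rho X Xp Z2 Z.
Proof.
have [N NE] := frame_left_inverse.
have coordE Z' := (cast_left_inverse (frame_dim hpn) Z' NE).1.
rewrite /metric /frame_coord !coordE mulmxBr !linearB /= !mulmxBl !linearB /=.
by rewrite mulrBr opprD addrACA.
Qed.

Lemma metric_definite (rho : R) Z : 0 < rho ->
  metric hpn rho X Xp Z Z = 0 -> Z = 0.
Proof.
move=> rho0; have [K ->] := frame_decomp Z.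
rewrite metricE => /eqP; set W := _ *m Z.
rewrite paddr_eq0 ?mulr_ge0 ?mxtrace_trmul_ge0 ?invr_ge0 ?(ltW rho0)//.
rewrite mulf_eq0 invr_eq0 (gt_eqF rho0) /= => /andP[/eqP /mxtrace_trmul_eq0 ->].
by move=> /eqP /mxtrace_trmul_eq0 ->; rewrite !mulmx0 addr0.
Qed.

(** The matrix P_f = H_X D, for an arbitrary D in place of the gradient. *)
Definition gradient_factor (rho : R) D : 'M[R]_(n + n, p + p) :=
  ((rho / 2) *: (X *m X^T) + 'J_n *m Xp *m Xp^T *m ('J_n)^T) *m D.

(** The X_perp term of H_X disappears because X_perp is orthogonal to X. *)
Lemma gradient_factor_dual rho D :
  (gradient_factor rho D)^T *m 'J_n *m (X *m 'J_p) =
  - ((rho / 2) *: (D^T *m X)).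
Proof.
rewrite /gradient_factor trmx_mul linearD /= linearZ /= !trmx_mul !trmxK.
rewrite mulmxDr !mulmxDl -!scalemxAr -!scalemxAl.
have -> : D^T *m (X *m X^T) *m 'J_n *m (X *m 'J_p) = - (D^T *m X).
  rewrite !mulmxA -(mulmxA _ X^T) -(mulmxA _ _ X) hX -(mulmxA _ 'J_p) mulmx_JJ.
  by rewrite mulmxN mulmx1.
have -> :
    D^T *m ('J_n *m (Xp *m (Xp^T *m ('J_n)^T))) *m 'J_n *m (X *m 'J_p) = 0.
  rewrite !mulmxA -(mulmxA _ (_^T) 'J_n) trJ_mulJ mulmx1 -(mulmxA _ Xp^T X).
  by rewrite -[Xp^T *m X]trmxK trmx_mul trmxK orth_complement_mul0 trmx0
    mulmx0 mul0mx.
by rewrite addr0 scalerN.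
Qed.

Lemma gradient_factor_dualX rho D :
  (gradient_factor rho D)^T *m 'J_n *m X =
  (rho / 2) *: (D^T *m (X *m 'J_p)).
Proof.
have := congr1 (fun A => A *m 'J_p) (gradient_factor_dual rho D).
rewrite mulNmx -scalemxAl !mulmxA -(mulmxA _ 'J_p) mulmx_JJ mulmxN mulmx1.
by move=> /oppr_inj.
Qed.

(** In the frame, S_X J X has coordinates W_0 = (rho/2) (T + T^T) with
    T = D^T X J, and K_0 = X_perp^T J^T D.  Tangency of Z makes its coordinate
    W symmetric, so that tr(T^T W) = tr(T W) and tr(W_0^T W) = rho tr(T W). *)
Lemma metric_gradient (rho : R) D Z : 0 < rho -> tangent_eq X Z ->
  metric hpn rho X Xp
    (sym_pair X (gradient_factor rho D) *m 'J_n *m X) Z = \tr (D^T *m Z).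
Proof.
move=> rho0 tZ; rewrite sym_pair_JX// gradient_factor_dualX.
set T := D^T *m (X *m 'J_p).
have -> : gradient_factor rho D + X *m 'J_p *m ((rho / 2) *: T) =
    X *m 'J_p *m ((rho / 2) *: (T^T + T)) +
    'J_n *m Xp *m (Xp^T *m ('J_n)^T *m D).
  rewrite scalerDr [in RHS]mulmxDr addrAC; congr (_ + _).
  rewrite /gradient_factor mulmxDl; congr (_ + _); last by rewrite !mulmxA.
  rewrite -scalemxAl -scalemxAr /T trmx_mul trmxK trmx_mul !mulmxA.
  by rewrite -(mulmxA X 'J_p) J_mul_trJ mulmx1.
have [K ZE] := frame_decomp Z.
set W := _ *m Z in ZE.
have symW : W^T = W.
  rewrite /W trmx_J mulmxN mulNmx linearN /=; congr (- _); exact/tangent_eqP.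
clearbody W.
rewrite ZE metricE mulmxDr mxtraceD !mulmxA -(mulmxA _ X) -/T.
congr (_ + _); last by rewrite !trmx_mul !trmxK !mulmxA.
have TtW : \tr (T^T *m W) = \tr (T *m W).
  by rewrite -mxtrace_tr trmx_mul trmxK symW mxtrace_mulC.
rewrite linearZ /= linearD /= trmxK -scalemxAl mulmxDl mxtraceZ mxtraceD TtW.
by field; rewrite gt_eqF.
Qed.

(** The difference of two gradients is tangent and orthogonal to itself. *)
Lemma riemannian_gradE (rho : R) fbar : 0 < rho ->
  riemannian_grad hpn rho Xp fbar X =
  sym_pair X (gradient_factor rho (euclid_grad fbar X)) *m 'J_n *m X.
Proof.
move=> rho0; set D := euclid_grad fbar X; set G := _ *m X.
have tG : tangent_eq X G by apply: sym_J_tangent; exact: sym_pair_sym.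
apply: xget_unique => [|G' [/(tangent_spaceP _ hX) tG' gradG']].
  split; first exact/tangent_spaceP.
  by move=> Z /(tangent_spaceP _ hX); exact: metric_gradient.
have tB : tangent_eq X (G' - G).
  rewrite /tangent_eq mulmxBr linearB /= !mulmxBl addrACA -opprD.
  by rewrite [X in X - _]tG' [X in _ - X]tG subrr.
apply/eqP; rewrite -subr_eq0; apply/eqP; apply: (metric_definite rho0).
rewrite metricBl gradG'; last exact/tangent_spaceP.
by rewrite metric_gradient// subrr.
Qed.

End Frame.

(** * The gradient formula *)

(** The matrices V^T J^T U and V^T J X of [cayley_factoredE] for U = [-P, X J]
    and V = [X J, -P]; every block that is simplified comes from the single
    pairing P^T J (X J) = - E^T or from X^T J X = J. *)
Lemma gradient_kernelE (R : realType) (p n : nat) (X : 'M[R]_(n + n, p + p))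
    (Xp : 'M[R]_(n + n, n + n - (p + p))) (rho : R) (D : 'M[R]_(n + n, p + p)) :
  SpStiefel R p n X -> orth_complement_mx X Xp ->
  let P := gradient_factor X Xp rho D in
  let E := (rho / 2) *: (X^T *m D) in
  (row_mx (X *m 'J_p) (- P))^T *m ('J_n)^T *m row_mx (- P) (X *m 'J_p) =
  block_mx E ('J_p)^T (P^T *m ('J_n)^T *m P) (- E^T) /\
  (row_mx (X *m 'J_p) (- P))^T *m 'J_n *m X = col_mx 1%:M (- (E^T *m 'J_p)).
Proof.
move=> hX hXp P E.
have PJQ : P^T *m 'J_n *m (X *m 'J_p) = - E^T.
  by rewrite gradient_factor_dual// /E [(_ *: _)^T]linearZ /= trmx_mul trmxK.
have QJP : (X *m 'J_p)^T *m ('J_n)^T *m P = - E.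
  by have := congr1 trmx PJQ; rewrite linearN /= !trmx_mul !trmxK !mulmxA.
have PJX : P^T *m 'J_n *m X = E^T *m 'J_p.
  rewrite gradient_factor_dualX// /E [(_ *: _)^T]linearZ /= trmx_mul trmxK.
  by rewrite -scalemxAl mulmxA.
rewrite tr_row_mx linearN /=; split.
  rewrite (mul_col_mx _ _ ('J_n)^T) mul_col_row mulmxN QJP opprK.
  rewrite SpStiefel_frame_form// mulmxN !mulNmx opprK; congr block_mx.
  by rewrite trmx_J mulmxN mulNmx opprK.
rewrite (mul_col_mx _ _ 'J_n) (mul_col_mx _ _ X) SpStiefel_dual//.
by rewrite !mulNmx PJX.
Qed.

Theorem proposition5p4 (R : realType) (p n : nat) (hp : (0 < p)%N)
    (hpn : (p <= n)%N) (X : 'M[R]_(n + n, p + p)) (hX : SpStiefel R p n X)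
    (t : R) :
  (forall L Q : 'M[R]_(n + n, p + p),
     let S := L *m Q^T + Q *m L^T in
     let U := row_mx L Q in
     let V := row_mx Q L in
     S = U *m V^T /\
     (1%:M + (t / 2) *: (V^T *m ('J_n)^T *m U) \in unitmx ->
      cayley_defined t S /\
      cayley_curve X t S =
        X + t *: (U *m invmx (1%:M + (t / 2) *: (V^T *m ('J_n)^T *m U))
                    *m V^T *m 'J_n *m X)))
  /\
  (forall (rho : R) (hrho : 0 < rho)
     (Xp : 'M[R]_(n + n, n + n - (p + p))) (hXp : orth_complement_mx X Xp)
     (f : SpStiefel R p n -> R) (fbar : 'M[R]_(n + n, p + p) -> R)
     (hf : smooth_extension f fbar X),
     let H := (rho / 2) *: (X *m X^T) + 'J_n *m Xp *m Xp^T *m ('J_n)^T in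
     let Pf := H *m euclid_grad fbar X in
     let Erho := (rho / 2) *: (X^T *m euclid_grad fbar X) in
     let SX := Pf *m (X *m 'J_p)^T + X *m 'J_p *m Pf^T in
     let L := - Pf in
     let Q := X *m 'J_p in
     let U := row_mx L Q in
     let V := row_mx Q L in
     let M := block_mx Erho ('J_p)^T (Pf^T *m ('J_n)^T *m Pf) (- Erho^T) in
     let gradf := riemannian_grad hpn rho Xp fbar X in
     1%:M + (t / 2) *: (V^T *m ('J_n)^T *m U) \in unitmx ->
     [/\ L *m Q^T + Q *m L^T = - SX,
         cayley_dom X (- (t *: gradf)),
         cayley_retraction X (- (t *: gradf)) = cayley_curve X t (- SX),
         1%:M + (t / 2) *: M \in unitmx &
         cayley_curve X t (- SX) =
           X + t *: (row_mx (- Pf) (X *m 'J_p)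
                       *m invmx (1%:M + (t / 2) *: M)
                       *m col_mx 1%:M (- (Erho^T *m 'J_p)))]).
Proof.
split=> [L Q S U V|rho rho0 Xp hXp f fbar _ H Pf Erho SX L Q U V M gradf uK].
  have SUV : S = U *m V^T by rewrite tr_row_mx mul_row_col.
  by rewrite SUV; split=> // uK; exact: cayley_factoredE.
have [kernelE rhsE] := gradient_kernelE rho (euclid_grad fbar X) hX hXp.
have SXE : L *m Q^T + Q *m L^T = - SX.
  by rewrite /L linearN /= mulNmx mulmxN -opprD.
have SUV : - SX = U *m V^T by rewrite -SXE tr_row_mx mul_row_col.
have [defined curveE] := cayley_factoredE X uK.
rewrite -SUV in defined curveE.
have gradE : gradf = sym_pair X Pf *m 'J_n *m X by exact: riemannian_gradE.
have stepE : - (t *: gradf) = sym_pair X (- t *: Pf) *m 'J_n *m X.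
  by rewrite gradE sym_pairZ !scaleNr !mulNmx -!scalemxAl.
have SE : cayley_S X (- (t *: gradf)) = t *: - SX.
  by rewrite stepE cayley_S_sym_pair// sym_pairZ scaleNr scalerN.
have halfE : 2^-1 *: (cayley_S X (- (t *: gradf)) *m 'J_n) =
    (t / 2) *: (- SX *m 'J_n).
  by rewrite SE -scalemxAl scalerA mulrC.
split.
- exact: SXE.
- split; last by rewrite halfE.
  apply/tangent_spaceP => //; rewrite stepE.
  exact/sym_J_tangent/sym_pair_sym.
- by rewrite /cayley_retraction halfE.
- by rewrite -[M]kernelE.
- by rewrite -[M]kernelE -rhsE curveE !mulmxA.
Qed.
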